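(* There is an absolute constant $C>0$ such that for every $\epsilon>0$ and positive integer $m$, with $M=m\epsilon^{-C\epsilon^{-5}}$, the following holds: for every measurable function $f\colon[0,1]^2\to[0,1]$ there is an integer $k\in[m,M]$ such that the partition of $[0,1]$ into the $k$ equal-length intervals $[0,1/k)\cup[1/k,2/k)\cup\dots\cup[(k-1)/k,1]$ is interval $\epsilon$-regular for $f$.
   Context: $\lambda$ denotes Lebesgue measure. For intervals $I,J\subseteq[0,1]$ of positive length, $d_f(I,J)=\frac{1}{\lambda(I)\lambda(J)}\int_{I\times J}f(x,y)\,dx\,dy$. A pair of intervals $(I,J)$ is interval $\epsilon$-regular for $f$ if for all subintervals $A\subseteq I$, $B\subseteq J$ with $\lambda(A)\ge\epsilon\lambda(I)$ and $\lambda(B)\ge\epsilon\lambda(J)$ one has $|d_f(A,B)-d_f(I,J)|\le\epsilon$. A partition $\mathcal{P}$ of $[0,1]$ into $k$ intervals is interval $\epsilon$-regular for $f$ if all except at most $\epsilon k^2$ pairs $(I,J)$ of intervals of $\mathcal{P}$ are interval $\epsilon$-regular for $f$.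
   Formalization: The formal statement assumes 0 < ε ≤ 1 instead of every ε > 0; for ε > 1 one has M = mε^{-Cε^{-5}} < m, so [m, M] is empty and the claim as written fails for every C > 0. *)

(* Defs.v *)
From HB Require Import structures.
From mathcomp Require Import all_boot all_order all_algebra.
From mathcomp Require Import all_classical all_reals all_analysis.

Set Implicit Arguments.
Unset Strict Implicit.
Unset Printing Implicit Defensive.

Import Order.TTheory GRing.Theory Num.Theory.
Import numFieldNormedType.Exports.

Local Open Scope classical_set_scope.
Local Open Scope ring_scope.

(* [lebesgue_measure \x lebesgue_measure] only measures the Borel sets of the
   plane; [lebesgue2] is its completion, i.e., the Lebesgue measure on the
   Lebesgue-measurable sets, which are the measurable sets of [plane R]. *)
Definition borel2 (R : realType)
    : {measure set (measurableTypeR R * measurableTypeR R) -> \bar R} :=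
  (lebesgue_measure \x lebesgue_measure)%E.

Definition plane (R : realType) : measurableType (borel2 R)^*%mu.-cara :=
  caratheodory_type (borel2 R)^*%mu.

Definition lebesgue2 (R : realType) : {measure set (plane R) -> \bar R} :=
  @completed_measure_extension _ _ _ (borel2 R).

Section IntervalRegularity.
Variable R : realType.
Implicit Types (f : plane R -> R) (I J A B : interval R) (eps : R).

Definition len I : R := fine (lebesgue_measure [set` I]).

Definition density f I J : R :=
  (\int[lebesgue2 R]_(z in [set` I] `*` [set` J]) f z) / (len I * len J).

Definition interval_regular f eps I J : Prop :=
  forall A B, [set` A] `<=` [set` I] -> [set` B] `<=` [set` J] ->
    eps * len I <= len A -> eps * len J <= len B ->
    `|density f A B - density f I J| <= eps.

(* A partition of [0, 1] into k intervals is given by the family of its parts,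
   so that pairs of parts are (ordered) pairs of indices. *)
Definition interval_regular_partition f eps (k : nat) (P : 'I_k -> interval R)
    : Prop :=
  #|[pred p : 'I_k * 'I_k | ~~ `[< interval_regular f eps (P p.1) (P p.2) >]]|%:R
    <= eps * k%:R ^+ 2.

Definition equipartition (k : nat) (i : 'I_k) : interval R :=
  if i.+1 == k then `[i%:R / k%:R, 1] else `[i%:R / k%:R, i.+1%:R / k%:R[.

Definition unit_square : set (plane R) := `[0, 1] `*` `[0, 1].

End IntervalRegularity.

(* Main.v *)
(* Energy increment along the partitions into k, kt, kt^2, ... equal intervals,
   with t of order eps^-2; the energy of a partition is the mean of the squared
   densities of its pairs of parts, which lies in [0, 1].
   If the pair (I, J) is irregular, as witnessed by A and B, let A' and B' be the
   unions of the parts of the refined partition that are contained in A and B.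
   A and B lose at most the length of two refined parts, so t >= 8 / eps^2 leaves a
   deviation of at least (eps / 2) |A| |B| between the integral of f over A' x B'
   and its expected value; by convexity of the square, the pair (I, J) contributes
   at least (eps^4 / 4) |I| |J| to the increase of the energy. More than eps k^2
   irregular pairs thus increase the energy by eps^5 / 4, which can happen at most
   4 / eps^5 times. For eps >= 4/5 every pair is regular, and for eps < 4/5 the
   factor t is at most eps^-12, whence C = 4 * 12. *)

Require Import Defs.
From mathcomp Require Import all_boot all_order all_algebra.
From mathcomp Require Import all_classical all_reals all_analysis.
From mathcomp Require Import ring lra zify.

Set Implicit Arguments.
Unset Strict Implicit.
Unset Printing Implicit Defensive.

Import Order.TTheory GRing.Theory Num.Theory.
Local Open Scope classical_set_scope.
Local Open Scope ring_scope.

(** * Integrals of [f] over rectangles in the unit square *)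

Lemma measurable_rectangle {R : realType} (X Y : set R) :
  measurable X -> measurable Y ->
  measurable ((X `*` Y : set (plane R))).
Proof.
move=> mX mY; apply: caratheodory_measurable_mu_ext; exact: measurableX.
Qed.

Lemma lebesgue2_rectangle {R : realType} (X Y : set R) :
  measurable X -> measurable Y ->
  lebesgue2 R (X `*` Y) = (lebesgue_measure X * lebesgue_measure Y)%E.
Proof.
move=> mX mY; rewrite -product_measure1E//.
by apply: measurable_mu_extE; exact: measurableX.
Qed.

Section mass.
Context {R : realType} {f : plane R -> R}.
Hypothesis mf : measurable_fun (@unit_square R) f.
Hypothesis f01 : forall z, @unit_square R z -> 0 <= f z <= 1.
Implicit Types (X Y : set R) (D : set (plane R)).

Lemma measurable_unit_square : measurable (@unit_square R).
Proof. exact: measurable_rectangle. Qed.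

Lemma lebesgue_measure01 : lebesgue_measure (`[0, 1]%classic : set R) = 1%E.
Proof. by rewrite lebesgue_measure_itv/= lte_fin ltr01 -EFinB subr0. Qed.

Lemma lebesgue2_unit_square : lebesgue2 R (@unit_square R) = 1%E.
Proof.
by rewrite lebesgue2_rectangle//= lebesgue_measure01 mule1.
Qed.

Lemma lebesgue2_fin_num D : measurable D -> D `<=` @unit_square R ->
  lebesgue2 R D \is a fin_num.
Proof.
move=> mD DQ; rewrite ge0_fin_numE//.
apply: (@le_lt_trans _ _ (lebesgue2 R (@unit_square R))).
  by apply: le_measure => //; rewrite inE//; exact: measurable_unit_square.
by rewrite lebesgue2_unit_square ltry.
Qed.

Lemma integrable_sub_unit_square D : measurable D -> D `<=` @unit_square R ->
  (lebesgue2 R).-integrable D (EFin \o f).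
Proof.
move=> mD DQ; apply: measurable_bounded_integrable => //.
- by rewrite -ge0_fin_numE//; exact: lebesgue2_fin_num.
- by apply: measurable_funS mf => //; exact: measurable_unit_square.
- exists 1; split => // x x1 z Dz; have /andP[f0 f1] := f01 (DQ _ Dz).
  by rewrite /= ger0_norm// (le_trans f1)// ltW.
Qed.

Lemma Rintegral_itv01 D : measurable D -> D `<=` @unit_square R ->
  0 <= \int[lebesgue2 R]_(z in D) f z <= fine (lebesgue2 R D).
Proof.
move=> mD DQ; rewrite Rintegral_ge0//=; last by move=> z /DQ /f01 /andP[].
rewrite -[leRHS]mul1r -Rintegral_cst//; apply: le_Rintegral => //.
- exact: integrable_sub_unit_square.
- apply: measurable_bounded_integrable => //.
    by rewrite -ge0_fin_numE//; exact: lebesgue2_fin_num.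
  by exists 1; split => // x x1 z Dz; rewrite /= normr1 ltW.
- by move=> z /DQ /f01 /andP[].
Qed.

(** Stated for sets rather than intervals, because the inner approximations of [A] and [B] are
    unions of parts. *)
Definition mass X Y : R := \int[lebesgue2 R]_(z in X `*` Y) f z.

Definition leb X : R := fine (lebesgue_measure X).

Lemma leb_ge0 X : 0 <= leb X.
Proof. by rewrite fine_ge0. Qed.

Lemma leb_fin_num X : measurable X -> X `<=` `[0, 1] ->
  lebesgue_measure X \is a fin_num.
Proof.
move=> mX X01; rewrite ge0_fin_numE//.
apply: (@le_lt_trans _ _ (lebesgue_measure `[0%R, 1%R]%classic)).
  by apply: le_measure; rewrite ?inE.
by rewrite lebesgue_measure01 ltry.
Qed.

Lemma le_leb X Y : measurable X -> measurable Y -> Y `<=` `[0, 1] -> X `<=` Y ->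
  leb X <= leb Y.
Proof.
move=> mX mY Y01 XY; apply: fine_le.
- by apply: leb_fin_num => //; exact: subset_trans Y01.
- exact: leb_fin_num.
- by apply: le_measure; rewrite ?inE.
Qed.

Lemma fine_lebesgue2_rectangle X Y : measurable X -> measurable Y ->
  X `<=` `[0, 1] -> Y `<=` `[0, 1] ->
  fine (lebesgue2 R (X `*` Y)) = leb X * leb Y.
Proof.
move=> mX mY X01 Y01; rewrite lebesgue2_rectangle// fineM//; exact: leb_fin_num.
Qed.

Lemma sub_rectangle X Y X' Y' : X' `<=` X -> Y' `<=` Y ->
  (X' `*` Y' : set (plane R)) `<=` X `*` Y.
Proof. by move=> XX YY [x y] [/= /XX ? /YY ?]. Qed.

Lemma mass_itv X Y : measurable X -> measurable Y ->
  X `<=` `[0, 1] -> Y `<=` `[0, 1] -> 0 <= mass X Y <= leb X * leb Y.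
Proof.
move=> mX mY X01 Y01; rewrite -fine_lebesgue2_rectangle//.
by apply: Rintegral_itv01; [exact: measurable_rectangle | exact: sub_rectangle].
Qed.

(** By additivity the difference is the integral of [f] over the complement of [X' * Y'] in [X * Y],
    where [f] lies between 0 and 1. *)
Lemma massB_itv X Y X' Y' :
  measurable X -> measurable Y -> measurable X' -> measurable Y' ->
  X `<=` `[0, 1] -> Y `<=` `[0, 1] -> X' `<=` X -> Y' `<=` Y ->
  0 <= mass X Y - mass X' Y' <= leb X * leb Y - leb X' * leb Y'.
Proof.
move=> mX mY mX' mY' X01 Y01 XX YY.
have mD := measurable_rectangle mX mY.
have mD' := measurable_rectangle mX' mY'.
have DQ : (X `*` Y : set (plane R)) `<=` @unit_square R by exact: sub_rectangle.
have DD := sub_rectangle XX YY.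
have X'01 : X' `<=` `[0, 1] by exact: subset_trans X01.
have Y'01 : Y' `<=` `[0, 1] by exact: subset_trans Y01.
rewrite -!fine_lebesgue2_rectangle//.
have mB := measurableD mD mD'.
have EU : X `*` Y = (X' `*` Y') `|` ((X `*` Y) `\` (X' `*` Y')) :> set (plane R).
  by rewrite setDUK.
have dis : [disjoint X' `*` Y' & ((X `*` Y) `\` (X' `*` Y') : set (plane R))].
  by rewrite disj_set2E classical_sets.setDIK.
have -> : mass X Y = mass X' Y' +
    \int[lebesgue2 R]_(z in (X `*` Y) `\` (X' `*` Y')) f z.
  rewrite /mass {1}EU Rintegral_setU//.
  rewrite -EU; exact: integrable_sub_unit_square.
rewrite addrAC subrr add0r.
have BQ : (X `*` Y) `\` (X' `*` Y') `<=` @unit_square R.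
  by move=> z [/DQ].
have -> : fine (lebesgue2 R (X `*` Y)) = fine (lebesgue2 R (X' `*` Y'))
    + fine (lebesgue2 R ((X `*` Y) `\` (X' `*` Y'))).
  rewrite -fineD; [|by apply: lebesgue2_fin_num => //; exact: subset_trans DQ|
                   exact: lebesgue2_fin_num].
  rewrite -measureU//; last by apply/eqP; rewrite -disj_set2E.
  by rewrite -EU.
rewrite [_ + _ - _]addrAC subrr add0r.
exact: Rintegral_itv01.
Qed.

(** The product of the two unions is the disjoint union of the rectangles [c i * c j], so the
    integral splits into a finite sum. *)
Lemma mass_bigcup (I : finType) (c : I -> set R) (S T : {set I}) :
  (forall i, measurable (c i)) -> (forall i, c i `<=` `[0, 1]) ->
  trivIset setT c ->
  mass (\bigcup_(i in [set` S]) c i) (\bigcup_(j in [set` T]) c j) =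
  \sum_(p | (p.1 \in S) && (p.2 \in T)) mass (c p.1) (c p.2).
Proof.
move=> mc c01 tc; pose P := [pred p : I * I | (p.1 \in S) && (p.2 \in T)].
pose F (p : I * I) : set (plane R) := c p.1 `*` c p.2.
have mF p : measurable (F p) by exact: measurable_rectangle.
have FQ p : F p `<=` @unit_square R by exact: sub_rectangle.
have EU : (\bigcup_(i in [set` S]) c i) `*` (\bigcup_(j in [set` T]) c j)
    = \big[setU/set0]_(p <- enum P) F p.
  rewrite -bigcup_seq; apply/seteqP; split.
    move=> [x y] [/= [i Si xi] [j Tj yj]]; exists (i, j) => //=.
    by rewrite mem_enum inE; apply/andP.
  move=> [x y] [[i j] /=]; rewrite mem_enum inE => /andP[Si Tj] [/= xi yj].
  by split => /=; [exists i|exists j].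
rewrite /mass /Rintegral EU integral_bigsetU_EFin//.
- rewrite -sum_fine; first by rewrite big_enum.
  move=> p _; apply: integrable_fin_num => //.
  exact: integrable_sub_unit_square.
- exact: enum_uniq.
- move=> [i j] [i' j'] _ _ [[x y] [[/= xi yj] [/= xi' yj']]].
  congr pair; first by apply: tc => //; exists x.
  by apply: tc => //; exists y.
- have : \big[setU/set0]_(p <- enum P) F p `<=` @unit_square R.
    by rewrite -bigcup_seq => z [p _ /FQ].
  move=> UQ; apply/measurable_realfun.measurable_EFinP.
  apply: measurable_funS mf => //.
  exact: measurable_unit_square.
Qed.

End mass.

Arguments mass {R} f X Y.

(** A product of lengths is the mass of the constant function 1, so this is an instance of
    [mass_bigcup]. *)
Lemma leb_bigcup (R : realType) (I : finType) (c : I -> set R) (S T : {set I}) :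
  (forall i, measurable (c i)) -> (forall i, c i `<=` `[0, 1]) ->
  trivIset setT c ->
  leb (\bigcup_(i in [set` S]) c i) * leb (\bigcup_(j in [set` T]) c j) =
  \sum_(p | (p.1 \in S) && (p.2 \in T)) leb (c p.1) * leb (c p.2).
Proof.
move=> mc c01 tc.
have mass1 (X Y : set R) : measurable X -> measurable Y ->
    X `<=` `[0, 1] -> Y `<=` `[0, 1] -> leb X * leb Y = mass (cst 1) X Y.
  move=> mX mY X01 Y01; rewrite /mass Rintegral_cst.
    by rewrite mul1r fine_lebesgue2_rectangle.
  exact: measurable_rectangle.
have mU (V : {set I}) : measurable (\bigcup_(i in [set` V]) c i).
  exact: fin_bigcup_measurable.
have U01 (V : {set I}) : (\bigcup_(i in [set` V]) c i) `<=` `[0, 1].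
  by move=> x [i _ /c01].
rewrite mass1// mass_bigcup//.
  by apply: eq_bigr => p _; rewrite mass1.
by move=> z _ /=; rewrite ler01 lexx.
Qed.

(** * The parts of the partition into equal intervals and their refinements *)

Section cells.
Context {R : realType}.

Definition cell (k : nat) (i : 'I_k) : set R := [set` equipartition R i].

(** The minimum matters only at the right end: at [x = 1] the truncation is [k], while 1 belongs to
    the last part, of index [k.-1]. *)
Definition cell_index (k : nat) (x : R) : nat :=
  minn (Num.truncn (x * k%:R)) k.-1.

(** Turns membership in a part into an equation between natural numbers; disjointness, covering and
    refinement of the parts all follow from it. *)
Lemma cellP k (i : 'I_k) x :
  cell i x <-> 0 <= x <= 1 /\ cell_index k x = i.
Proof.
have k0 : (0 < k)%N by case: k i => [[]|].
have kR : 0 < k%:R :> R by rewrite ltr0n.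
have ik := ltn_ord i; rewrite /cell /equipartition /cell_index.
have bnd n : n%:R / k%:R <= x = (n%:R <= x * k%:R) by rewrite ler_pdivrMr.
have bnd' n : x < n%:R / k%:R = (x * k%:R < n%:R) by rewrite ltr_pdivlMr.
have x1E : x <= 1 = (x * k%:R <= k%:R) by rewrite ger_pMl.
split.
  case: eqP => ek /=; rewrite !in_itv/= bnd ?bnd' => /andP[xi xj].
    have x0 : 0 <= x by rewrite -(pmulr_lge0 _ kR) (le_trans _ xi).
    split; first by rewrite x0.
    have : (i <= Num.truncn (x * k%:R))%N.
      by rewrite truncn_ge_nat// mulr_ge0.
    lia.
  have x0 : 0 <= x by rewrite -(pmulr_lge0 _ kR) (le_trans _ xi).
  rewrite x0 x1E (le_trans (ltW xj)) ?ler_nat//; split => //.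
  rewrite (@truncn_def _ _ i) ?xi//; lia.
move=> [/andP[x0 x1] /esym].
have /andP[tl tu] := truncn_itv (mulr_ge0 x0 (ltW kR)).
set b := Num.truncn _ in tl tu *; move=> ei.
case: eqP => ek; rewrite /= in_itv/= bnd ?x1 ?bnd' ?andbT.
  by rewrite (le_trans _ tl)// ler_nat; lia.
have -> : nat_of_ord i = b by lia.
by rewrite tl tu.
Qed.

Lemma measurable_cell k (i : 'I_k) : measurable (cell i).
Proof. exact: measurable_itv. Qed.

Lemma cell_sub01 k (i : 'I_k) : cell i `<=` `[0, 1].
Proof. by move=> x /cellP[]. Qed.

Lemma trivIset_cell k : trivIset [set: 'I_k] (@cell k).
Proof.
move=> i j _ _ [x [/cellP[_ xi] /cellP[_ xj]]].
by apply/val_inj; rewrite /= -xi -xj.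
Qed.

Lemma cell_cover k x : (0 < k)%N -> 0 <= x <= 1 -> exists i : 'I_k, cell i x.
Proof.
move=> k0 x01; have h : (cell_index k x < k)%N by rewrite /cell_index; lia.
by exists (Ordinal h); apply/cellP.
Qed.

Lemma cell_bounds k (i : 'I_k) x : cell i x ->
  i%:R / k%:R <= x <= i.+1%:R / k%:R.
Proof.
rewrite /cell /equipartition; case: eqP => ek; rewrite /= in_itv/= => /andP[-> //].
  by rewrite ek divff// pnatr_eq0; move: (ltn_ord i); lia.
by move/ltW.
Qed.

Lemma cell_diam k (i : 'I_k) x y : cell i x -> cell i y -> x <= y + k%:R^-1.
Proof.
move=> /cell_bounds /andP[_ h] /cell_bounds /andP[h' _]; apply: (le_trans h).
by rewrite -addn1 natrD mulrDl mul1r lerD2r.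
Qed.

Lemma leb_cell k (i : 'I_k) : leb (cell i) = k%:R^-1.
Proof.
have kR : 0 < k%:R :> R by rewrite ltr0n; case: k i => [[]|].
have E : i.+1%:R / k%:R - i%:R / k%:R = k%:R^-1 :> R.
  by rewrite -mulrBl -natrB// subSnn mul1r.
have lt : i%:R / k%:R < i.+1%:R / k%:R :> R.
  by rewrite ltr_pM2r ?invr_gt0// ltr_nat.
rewrite /leb /cell /equipartition; case: eqP => ek.
  have -> : `[i%:R / k%:R, 1] = `[i%:R / k%:R, i.+1%:R / k%:R] :> interval R.
    by rewrite ek divff// gt_eqF.
  by rewrite lebesgue_measure_itv/= lte_fin lt -EFinB/= E.
by rewrite lebesgue_measure_itv/= lte_fin lt -EFinB/= E.
Qed.

Lemma coarse_subproof k t (j : 'I_(k * t)) : (j %/ t < k)%N.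
Proof.
have t0 : (0 < t)%N by case: t j => // j; case: j => j; rewrite muln0.
by rewrite ltn_divLR.
Qed.

Definition coarse k t (j : 'I_(k * t)) : 'I_k := Ordinal (coarse_subproof j).

(** With [a] and [b] the integer parts of [x * k * t] and [x * k], one has [b * t <= a < b.+1 * t],
    hence [a %/ t = b]. The caps at the last part agree as well, since [(k * t).-1 %/ t = k.-1]. *)
Lemma cell_index_coarse k t x : (0 < k)%N -> (0 < t)%N -> 0 <= x ->
  cell_index k x = (cell_index (k * t) x %/ t)%N.
Proof.
move=> k0 t0 x0; rewrite /cell_index.
have tR : 0 < t%:R :> R by rewrite ltr0n.
have xk0 : 0 <= x * k%:R by rewrite mulr_ge0.
have xkt0 : 0 <= x * (k * t)%:R by rewrite mulr_ge0.
have /andP[bl bu] := truncn_itv xk0; set b := Num.truncn _ in bl bu *.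
have /andP[al au] := truncn_itv xkt0; set a := Num.truncn _ in al au *.
move: al au; rewrite natrM mulrA => al au.
have h1 : (b * t < a.+1)%N.
  by rewrite -(@ltr_nat R) natrM (le_lt_trans _ au)// ler_pM2r.
have h2 : (a < b.+1 * t)%N.
  by rewrite -(@ltr_nat R) natrM (le_lt_trans al)// ltr_pM2r.
have ab : (a %/ t)%N = b.
  by apply/eqP; rewrite eqn_leq leq_divRL// -ltnS ltn_divLR// h2 -ltnS h1.
have kt : ((k * t).-1 %/ t)%N = k.-1.
  by apply/eqP; rewrite eqn_leq leq_divRL// -ltnS ltn_divLR//; nia.
rewrite /minn; case: ifP => h; case: ifP => h' //; rewrite ?ab ?kt//.
  by apply/eqP; rewrite eqn_leq; nia.
by apply/eqP; rewrite eqn_leq; nia.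
Qed.

Lemma cell_sub_coarse k t (j : 'I_(k * t)) : cell j `<=` cell (coarse j).
Proof.
move=> x /cellP[x01 xj]; apply/cellP; split => //=.
have jkt := ltn_ord j; have k0 : (0 < k)%N by nia.
have t0 : (0 < t)%N by nia.
by case/andP: x01 => x0 _; rewrite (@cell_index_coarse k t) ?xj.
Qed.

Lemma cell_bigcup k t (i : 'I_k) : (0 < t)%N ->
  cell i = \bigcup_(j in [set` [set j | @coarse k t j == i]%SET]) cell j.
Proof.
move=> t0; apply/seteqP; split => [x xi|x [j /=]]; last first.
  by rewrite inE => /eqP <- /cell_sub_coarse.
have kt0 : (0 < k * t)%N by move: (ltn_ord i); nia.
have [j xj] := cell_cover kt0 (cell_sub01 xi).
exists j => //=; rewrite inE; apply/eqP; apply: (@trivIset_cell k) => //.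
by exists x; split => //; exact: cell_sub_coarse.
Qed.

Definition inner_cells k (A : set R) : {set 'I_k} :=
  [set j : 'I_k | `[< cell j `<=` A >]]%SET.

(** A point of [A] further than [1 / k] from both [inf A] and [sup A] lies in a part contained in
    [A], because parts have diameter at most [1 / k] and [A] is an interval. The other points are
    covered by two intervals of length [1 / k]. *)
Lemma leb_inner_cells k (A : set R) : (0 < k)%N -> measurable A ->
  is_interval A -> A `<=` `[0, 1] ->
  leb A <= leb (\bigcup_(j in [set` inner_cells k A]) cell j) + 2 / k%:R.
Proof.
move=> k0 mA iA A01; set U := \bigcup_(j in _) _.
have U01 : U `<=` `[0, 1] by move=> x [j _ /cell_sub01].
have mU : measurable U.
  by apply: fin_bigcup_measurable => // j _; exact: measurable_cell.
(* The infimum and supremum of the empty set are mere default values, so this case is separate. *)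
have [->|A0] := eqVneq A set0.
  by rewrite /leb measure0 addr_ge0 ?leb_ge0// divr_ge0.
move/set0P : A0 => A0.
have kV : 0 < k%:R^-1 :> R by rewrite invr_gt0 ltr0n.
have lbA : has_lbound A.
  by exists 0 => x /A01 /=; rewrite in_itv/= => /andP[].
have ubA : has_ubound A.
  by exists 1 => x /A01 /=; rewrite in_itv/= => /andP[].
pose I1 : interval R := `[inf A, inf A + k%:R^-1].
pose I2 : interval R := `[sup A - k%:R^-1, sup A].
have leb1 : lebesgue_measure [set` I1] = (k%:R^-1)%:E.
  by rewrite lebesgue_measure_itv/= lte_fin ltrDl kV -EFinB addrAC subrr add0r.
have leb2 : lebesgue_measure [set` I2] = (k%:R^-1)%:E.
  by rewrite lebesgue_measure_itv/= lte_fin gtrBl kV -EFinB subKr.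
have AU : A `<=` U `|` ([set` I1] `|` [set` I2]).
  move=> x Ax; have [x1|x1] := leP x (inf A + k%:R^-1).
    by right; left; rewrite /= in_itv/= x1 andbT; exact: ge_inf.
  have [x2|x2] := leP (sup A - k%:R^-1) x.
    by right; right; rewrite /= in_itv/= x2; exact: ub_le_sup.
  have [j xj] := cell_cover k0 (A01 _ Ax).
  left; exists j => //=; rewrite inE; apply/asboolP => y yj.
  (* Any [y] in the part of [x] lies strictly between [inf A] and [sup A], hence between two points
     of [A]. *)
  have [u Au uy] : exists2 u, A u & u < y.
    by apply: inf_lt => //; have := cell_diam xj yj; lra.
  have [v Av yv] : exists2 v, A v & y < v.
    by apply: sup_gt => //; have := cell_diam yj xj; lra.
  by apply: (iA u v) => //; rewrite (ltW uy) (ltW yv).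
have -> : 2 / k%:R = k%:R^-1 + k%:R^-1 :> R by lra.
rewrite -lee_fin !EFinD fineK ?leb_fin_num// fineK ?leb_fin_num//.
apply: (@le_trans _ _ (lebesgue_measure (U `|` ([set` I1] `|` [set` I2])))).
  by apply: le_measure => //; rewrite inE//; do 2 apply: measurableU => //.
apply: (le_trans (measureU2 _ _ _)) => //; first exact: measurableU.
rewrite leeD2l//; apply: (le_trans (measureU2 _ _ _)) => //.
by rewrite [X in (X + _)%E]leb1 [X in (_ + X)%E]leb2.
Qed.

Lemma inner_cells_coarse k t (A : set R) (i : 'I_k) j :
  A `<=` cell i -> j \in inner_cells (k * t) A -> @coarse k t j = i.
Proof.
move=> Ai; rewrite inE => /asboolP jA; apply: (@trivIset_cell k) => //.
(* The left endpoint shows that the part is nonempty; being common to [cell i] and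
   [cell (coarse j)], it forces the two indices to agree. *)
have j0 : cell j (j%:R / (k * t)%:R).
  have kt : 0 < (k * t)%:R :> R by rewrite ltr0n; move: (ltn_ord j); lia.
  rewrite /cell /equipartition; case: eqP => ek; rewrite /= in_itv/= lexx/=.
    by rewrite ler_pdivrMr// mul1r ler_nat ltnW.
  by rewrite ltr_pM2r ?invr_gt0// ltr_nat.
by exists (j%:R / (k * t)%:R); split; [exact: cell_sub_coarse|exact/Ai/jA].
Qed.

End cells.

(** * Deviation of the integral from its expected value *)

Section regularity.
Context {R : realType} {f : plane R -> R}.
Hypothesis mf : measurable_fun (@unit_square R) f.
Hypothesis f01 : forall z, @unit_square R z -> 0 <= f z <= 1.

Let m_cell k (i : 'I_k) := @measurable_cell R k i.
Let cell01 k (i : 'I_k) := @cell_sub01 R k i.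

Definition cell_mass k (p : 'I_k * 'I_k) : R := mass f (cell p.1) (cell p.2).

Lemma cell_mass_itv k (p : 'I_k * 'I_k) : 0 <= cell_mass p <= k%:R ^- 2.
Proof.
have := mass_itv mf f01 (@m_cell _ p.1) (@m_cell _ p.2) (@cell01 _ _) (@cell01 _ _).
by rewrite !leb_cell -exprVn expr2.
Qed.

Lemma density_cell k (i j : 'I_k) :
  density f (equipartition R i) (equipartition R j) =
  cell_mass (i, j) * k%:R ^+ 2.
Proof.
rewrite /density; congr (_ * _).
have := leb_cell i; have := leb_cell j; rewrite /leb /cell /len => -> ->.
by rewrite -invfM invrK expr2.
Qed.

(* The deviation [mass - d * area] is monotone up to the area removed, because
   both [f] and [d] take values in [0, 1]. *)
Lemma deviation_sub (d : R) (X Y X' Y' : set R) : 0 <= d <= 1 ->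
  measurable X -> measurable Y -> measurable X' -> measurable Y' ->
  X `<=` `[0, 1] -> Y `<=` `[0, 1] -> X' `<=` X -> Y' `<=` Y ->
  `|(mass f X Y - d * (leb X * leb Y)) - (mass f X' Y' - d * (leb X' * leb Y'))|
    <= leb X * leb Y - leb X' * leb Y'.
Proof.
move=> /andP[d0 d1] mX mY mX' mY' X01 Y01 XX YY.
have /andP[h0 h1] := massB_itv mf f01 mX mY mX' mY' X01 Y01 XX YY.
set D := leb X * leb Y - _ in h1 *; have D0 : 0 <= D by exact: le_trans h1.
have -> : (mass f X Y - d * (leb X * leb Y)) - (mass f X' Y' - d * (leb X' * leb Y'))
  = (mass f X Y - mass f X' Y') - d * D by rewrite /D; ring.
rewrite ler_norml; apply/andP; split; nra.
Qed.

(** The deviation of the whole pair from its own density is 0, so that of [A * B] is at most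
    [|I| |J| - |A| |B|]. Since [|A| |B| >= eps^2 |I| |J|] and [(1 + eps) * eps^2 >= 1] for
    [eps >= 4/5], this is at most [eps |A| |B|]. *)
Lemma interval_regular_cell_large_eps (eps : R) k (i j : 'I_k) : 4 / 5 <= eps ->
  interval_regular f eps (equipartition R i) (equipartition R j).
Proof.
move=> e45 A B AI BJ lA lB; rewrite density_cell.
have kR : 0 < k%:R :> R by rewrite ltr0n; case: k i {j AI BJ lA lB} => [[]|].
have kV : 0 < k%:R^-1 :> R by rewrite invr_gt0.
have /andP[m0 m1] := cell_mass_itv (i, j).
set d := cell_mass (i, j) * _.
have d01 : 0 <= d <= 1.
  by rewrite mulr_ge0 ?exprn_ge0//= -ler_pdivlMr ?exprn_gt0// mul1r.
have := deviation_sub d01 (@m_cell _ i) (@m_cell _ j) (measurable_itv A)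
  (measurable_itv B) (@cell01 _ _) (@cell01 _ _) AI BJ.
move: lA lB; rewrite /len -!/(leb _) -/(cell i) -/(cell j) !leb_cell.
rewrite -/(cell_mass (i, j)) -/(mass f [set` A] [set` B]).
set a := leb _; set b := leb _ => la lb.
have -> : cell_mass (i, j) - d * (k%:R^-1 * k%:R^-1) = 0.
  by rewrite /d; field; rewrite gt_eqF.
rewrite sub0r normrN => dev.
have e0 : 0 < eps by lra.
have a0 : 0 < a by rewrite (lt_le_trans _ la)// mulr_gt0.
have b0 : 0 < b by rewrite (lt_le_trans _ lb)// mulr_gt0.
have ab0 : 0 < a * b by rewrite mulr_gt0.
have -> : density f A B - d = (mass f [set` A] [set` B] - d * (a * b)) / (a * b).
  by rewrite mulrBl mulfK ?gt_eqF.
rewrite normrM normfV (gtr0_norm ab0) ler_pdivrMr// (le_trans dev)//.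
have : eps * k%:R^-1 * (eps * k%:R^-1) <= a * b.
  by rewrite ler_pM// mulr_ge0// ltW.
set w := k%:R^-1 * k%:R^-1.
have -> : eps * k%:R^-1 * (eps * k%:R^-1) = eps ^+ 2 * w.
  by rewrite /w; ring.
have w0 : 0 < w by rewrite mulr_gt0.
move: (a * b) ab0 => s s0 hs.
have : 1 <= (1 + eps) * eps ^+ 2 by nra.
move=> h1; have : w <= (1 + eps) * (eps ^+ 2 * w) by nra.
by nra.
Qed.

(** * The energy and its increase under refinement *)

Definition fiber k t (P : 'I_k * 'I_k) : pred ('I_(k * t) * 'I_(k * t)) :=
  [pred p | (coarse p.1 == P.1) && (coarse p.2 == P.2)].
Arguments fiber {k} t P.

Lemma cell_mass_fiber k t (P : 'I_k * 'I_k) : (0 < t)%N ->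
  cell_mass P = \sum_(p in fiber t P) cell_mass p.
Proof.
move=> t0; rewrite /cell_mass (cell_bigcup P.1 t0) (cell_bigcup P.2 t0).
rewrite (mass_bigcup mf f01)//.
- by apply: eq_bigl => p; rewrite !inE.
- exact: trivIset_cell.
Qed.

Lemma area_fiber k t (P : 'I_k * 'I_k) : (0 < t)%N ->
  k%:R ^- 2 = \sum_(p in fiber t P) (k * t)%:R ^- 2 :> R.
Proof.
move=> t0; rewrite -!exprVn expr2 -{1}(leb_cell P.1) -(leb_cell P.2).
rewrite (cell_bigcup P.1 t0) (cell_bigcup P.2 t0) leb_bigcup//.
- by apply: eq_big => [p|p _]; rewrite ?inE// !leb_cell expr2.
- exact: trivIset_cell.
Qed.

(** A pair has density [k^2 * cell_mass p] and area [k^-2], so this is the mean of the squared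
    densities. *)
Definition energy k : R := \sum_(p : 'I_k * 'I_k) k%:R ^+ 2 * cell_mass p ^+ 2.

(** The area-weighted squared distance between the densities of the refined pairs inside [P] and the
    density of [P]. *)
Definition variance k t (P : 'I_k * 'I_k) : R := \sum_(p in fiber t P)
  (k * t)%:R ^- 2 * ((k * t)%:R ^+ 2 * cell_mass p - k%:R ^+ 2 * cell_mass P) ^+ 2.

(** Pythagoras: after expanding the square, the cross term is evaluated by summing masses over each
    fiber and the constant term by summing areas. *)
Lemma energy_refine k t : (0 < k)%N -> (0 < t)%N ->
  energy (k * t) = energy k + \sum_(P : 'I_k * 'I_k) variance t P.
Proof.
move=> k0 t0; rewrite /energy (partition_big (fun p : 'I_(k * t) * 'I_(k * t) =>
  (coarse p.1, coarse p.2)) predT)//= -big_split/=; apply: eq_bigr => P _.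
have kR : k%:R != 0 :> R by rewrite pnatr_eq0 -lt0n.
rewrite (eq_bigl [in fiber t P]); last by move=> p; rewrite inE -pair_eqE.
have ktR : (k * t)%:R != 0 :> R by rewrite pnatr_eq0 -lt0n muln_gt0 k0.
have expand (x : R) (y : R) : (k * t)%:R ^- 2 *
    ((k * t)%:R ^+ 2 * x - k%:R ^+ 2 * y) ^+ 2 = (k * t)%:R ^+ 2 * x ^+ 2 +
    (- (2 * k%:R ^+ 2 * y) * x + (k%:R ^+ 2 * y) ^+ 2 * (k * t)%:R ^- 2).
  by move: (k * t)%:R ktR => K K0; field.
rewrite /variance; under [in RHS]eq_bigr => p _ do rewrite expand.
rewrite !big_split/= -!big_distrr/= -cell_mass_fiber// -area_fiber//.
by field; rewrite kR.
Qed.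

Lemma variance_ge0 k t (P : 'I_k * 'I_k) : 0 <= variance t P.
Proof.
by apply: sumr_ge0 => p _; rewrite mulr_ge0 ?sqr_ge0// invr_ge0 exprn_ge0.
Qed.

Lemma energy_ge0 k : 0 <= energy k.
Proof. by apply: sumr_ge0 => p _; rewrite mulr_ge0 ?sqr_ge0// exprn_ge0. Qed.

(** Each of the [k^2] terms is at most [k^-2], as a mass is at most the area of its pair. *)
Lemma energy_le1 k : energy k <= 1.
Proof.
case: k => [|k]; first by rewrite /energy big1// => -[[]].
have kR : 0 < k.+1%:R ^+ 2 :> R by rewrite exprn_gt0.
rewrite (@le_trans _ _ (\sum_(p : 'I_k.+1 * 'I_k.+1) k.+1%:R ^- 2))//.
  apply: ler_sum => p _; have /andP[m0 m1] := cell_mass_itv p.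
  rewrite expr2 mulrA -[leRHS]mul1r ler_pM// ?mulr_ge0// ?(ltW kR)//.
  by rewrite -ler_pdivlMl// mulr1.
rewrite sumr_const card_prod card_ord -[leLHS]mulr_natr natrM -expr2 mulVf//.
Qed.

Lemma variance_irregular (eps : R) k t (i j : 'I_k) :
  0 < eps -> 8 <= t%:R * eps ^+ 2 ->
  ~ interval_regular f eps (equipartition R i) (equipartition R j) ->
  k%:R ^- 2 * (eps ^+ 4 / 4) <= variance t (i, j).
Proof.
move=> e0 te nreg.
have kR : 0 < k%:R :> R by rewrite ltr0n; case: k i {j nreg} => [[]|].
have tR : 0 < t%:R :> R by have := sqr_ge0 eps; nra.
have k0 : (0 < k)%N by rewrite -(ltr0n R).
have t0 : (0 < t)%N by rewrite -(ltr0n R).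
have kt0 : (0 < k * t)%N by rewrite muln_gt0 k0.
have /andP[m0 m1] := cell_mass_itv (i, j).
set d := k%:R ^+ 2 * cell_mass (i, j).
have d01 : 0 <= d <= 1.
  by rewrite mulr_ge0 ?exprn_ge0//= -ler_pdivlMl ?exprn_gt0// mulr1.
move: nreg; rewrite /interval_regular => /existsNP[A] /existsNP[B].
move=> /not_implyP[AI] /not_implyP[BJ] /not_implyP[lA] /not_implyP[lB].
move=> /negP; rewrite -ltNge density_cell mulrC -/d.
move: lA lB; rewrite /density /len -!/(leb _) -/(cell i) -/(cell j) !leb_cell.
rewrite -/(mass f [set` A] [set` B]) => lA lB irr.
have A01 : [set` A] `<=` `[0, 1] by exact: subset_trans (@cell01 _ i).
have B01 : [set` B] `<=` `[0, 1] by exact: subset_trans (@cell01 _ j).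
pose S := inner_cells (k * t) [set` A]; pose T := inner_cells (k * t) [set` B].
pose A' := \bigcup_(x in [set` S]) @cell R _ x.
pose B' := \bigcup_(x in [set` T]) @cell R _ x.
have mU (V : {set 'I_(k * t)}) : measurable (\bigcup_(x in [set` V]) @cell R _ x).
  by apply: fin_bigcup_measurable => // x _; exact: m_cell.
have AA : A' `<=` [set` A] by move=> x [y /=]; rewrite inE => /asboolP; exact.
have BB : B' `<=` [set` B] by move=> x [y /=]; rewrite inE => /asboolP; exact.
have lAA : leb [set` A] <= leb A' + 2 / (k * t)%:R.
  by apply: leb_inner_cells => //; exact: interval_is_interval.
have lBB : leb [set` B] <= leb B' + 2 / (k * t)%:R.
  by apply: leb_inner_cells => //; exact: interval_is_interval.
have := deviation_sub d01 (measurable_itv A) (measurable_itv B) (mU S) (mU T)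
  A01 B01 AA BB; rewrite -/A' -/B' => dev.
have lA'A : leb A' <= leb [set` A] by apply: le_leb => //; exact: mU.
have lB'B : leb B' <= leb [set` B] by apply: le_leb => //; exact: mU.
have kV : 0 < k%:R^-1 :> R by rewrite invr_gt0.
have a0 : 0 < leb [set` A] by rewrite (lt_le_trans _ lA)// mulr_gt0.
have b0 : 0 < leb [set` B] by rewrite (lt_le_trans _ lB)// mulr_gt0.
have a'0 : 0 <= leb A' by exact: leb_ge0.
have b'0 : 0 <= leb B' by exact: leb_ge0.
have mS : mass f A' B' = \sum_(p | (p.1 \in S) && (p.2 \in T)) cell_mass p.
  by rewrite (mass_bigcup mf f01)//; exact: trivIset_cell.
have lS : leb A' * leb B' =
    \sum_(p : 'I_(k * t) * 'I_(k * t) | (p.1 \in S) && (p.2 \in T)) (k * t)%:R ^- 2.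
  rewrite leb_bigcup//; last exact: trivIset_cell.
  by apply: eq_bigr => p _; rewrite !leb_cell -exprVn expr2.
have subQ : {subset [pred p | (p.1 \in S) && (p.2 \in T)] <= fiber t (i, j)}.
  move=> p; rewrite !inE => /andP[pS pT].
  by apply/andP; split; apply/eqP; [apply: inner_cells_coarse AI _|
    apply: inner_cells_coarse BJ _]; rewrite inE.
(* Convexity in tangent form: [y^2 >= 2 * c * y - c^2] for the density deviation [y] of each refined
   pair inside [A' * B'], weighted by area; the nonnegative terms outside are dropped. Leaving [c]
   free avoids dividing by the area of [A' * B'], which would have to be nonzero. *)
have var (c : R) : 2 * c * (mass f A' B' - d * (leb A' * leb B'))
    - c ^+ 2 * (leb A' * leb B') <= variance t (i, j).
  rewrite /variance -/d [leRHS](bigID [pred p | (p.1 \in S) && (p.2 \in T)])/=.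
  rewrite -[leLHS]addr0 lerD//; last first.
    by apply: sumr_ge0 => p _; rewrite mulr_ge0 ?sqr_ge0// invr_ge0 exprn_ge0.
  rewrite [leRHS](eq_bigl [pred p | (p.1 \in S) && (p.2 \in T)]); last first.
    move=> p; apply/andP/idP => [[]//|pQ]; split => //.
    exact: subQ.
  rewrite mS lS !mulr_sumr -sumrB !mulr_sumr -sumrB; apply: ler_sum => p _.
  have : 0 < (k * t)%:R ^+ 2 :> R by rewrite exprn_gt0// ltr0n.
  move: (_ ^+ 2) (cell_mass p) => K x K0.
  rewrite -subr_ge0 (_ : _ - _ = K^-1 * (K * x - d - c) ^+ 2).
    by rewrite mulr_ge0 ?sqr_ge0// invr_ge0 ltW.
  by field; rewrite gt_eqF.
move: (variance t (i, j)) var {mS lS subQ} => V var.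
move: dev irr lA lB lAA lBB lA'A lB'B a0 b0 a'0 b'0 var.
move: (mass f [set` A] [set` B]) (mass f A' B') => M M'.
move: (leb [set` A]) (leb [set` B]) (leb A') (leb B') => a b a' b'.
move=> dev irr la lb laa lbb a'a b'b a0 b0 a'0 b'0 var.
have ab0 : 0 < a * b by rewrite mulr_gt0.
have {}irr : eps * (a * b) < `|M - d * (a * b)|.
  rewrite -ltr_pdivlMr// -[X in _ / X]gtr0_norm// -normf_div mulrBl mulfK//.
  by rewrite gt_eqF.
(* This is where [t * eps^2 >= 8] enters: with [|A|, |B| >= eps / k], each of [A] and [B] loses at
   most the fraction [eps / 4] of its length. *)
have q2 : 2 / (k * t)%:R <= eps ^+ 2 / (4 * k%:R) :> R.
  rewrite natrM ler_pdivrMr ?mulr_gt0// -subr_ge0.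
  rewrite (_ : _ - _ = (t%:R * eps ^+ 2 - 8) / 4); last by field; rewrite gt_eqF.
  by rewrite divr_ge0// subr_ge0.
have qa : 2 / (k * t)%:R <= a * eps / 4.
  apply: (le_trans q2); rewrite (_ : _ / _ = eps * k%:R^-1 * (eps / 4)).
    by rewrite -(mulrA a) ler_pM2r// divr_gt0.
  by field; rewrite gt_eqF.
have qb : 2 / (k * t)%:R <= b * eps / 4.
  apply: (le_trans q2); rewrite (_ : _ / _ = eps * k%:R^-1 * (eps / 4)).
    by rewrite -(mulrA b) ler_pM2r// divr_gt0.
  by field; rewrite gt_eqF.
(* The lost area consists of two strips, each at most [eps / 4] of [a * b]. *)
have ss : a * b - a' * b' <= eps / 2 * (a * b).
  have -> : a * b - a' * b' = (a - a') * b + a' * (b - b') by ring.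
  have h1 : (a - a') * b <= (a * eps / 4) * b by rewrite ler_pM2r//; lra.
  have h2 : a' * (b - b') <= a * (b * eps / 4) by rewrite ler_pM//; lra.
  lra.
(* The deviation on [A * B] exceeds [eps * (a * b)] and changes by at most the lost area, so half of
   it survives. *)
have X0 : eps / 2 * (a * b) <= `|M' - d * (a' * b')|.
  move: dev irr; move: (M - _) (M' - _) => Y X dev irr.
  have := ler_normD (Y - X) X; rewrite subrK; lra.
have s's : a' * b' <= a * b by rewrite ler_pM.
have sk : eps ^+ 2 * k%:R ^- 2 <= a * b.
  by rewrite -exprVn -exprMn expr2 ler_pM// mulr_ge0// ltW.
(* Take [c = eps / 2] with the sign of the surviving deviation: the linear term gives at least
   [eps^2 / 2 * (a * b)], and the quadratic one costs at most [eps^2 / 4 * (a * b)]. *)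
have goal1 : eps ^+ 2 / 4 * (a * b) <= V.
  move: var X0 s's; move: (M' - _) => X.
  move: (a * b) (a' * b') => s s' var X0 s's.
  have h1 : eps * (eps / 2 * s) <= eps * `|X| by rewrite ler_pM2l.
  have h2 : eps ^+ 2 * s' <= eps ^+ 2 * s by rewrite ler_wpM2l// sqr_ge0.
  have [X'|X'] := leP 0 X.
    by move: h1 (var (eps / 2)); rewrite ger0_norm//; lra.
  by move: h1 (var (- (eps / 2))); rewrite ltr0_norm//; lra.
apply: le_trans goal1.
have -> : k%:R ^- 2 * (eps ^+ 4 / 4) = eps ^+ 2 / 4 * (eps ^+ 2 * k%:R ^- 2).
  by field; rewrite gt_eqF.
by rewrite ler_wpM2l// divr_ge0// sqr_ge0.
Qed.

Lemma energy_increment (eps : R) k t : (0 < k)%N -> 0 < eps ->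
  8 <= t%:R * eps ^+ 2 ->
  ~ interval_regular_partition f eps (@equipartition R k) ->
  energy k + eps ^+ 5 / 4 <= energy (k * t).
Proof.
move=> k0 e0 te; have kR : 0 < k%:R :> R by rewrite ltr0n.
have t0 : (0 < t)%N by rewrite -(ltr0n R); have := sqr_ge0 eps; nra.
rewrite /interval_regular_partition => /negP; rewrite -ltNge.
set Q := [pred p | _] => irr; rewrite energy_refine// lerD2l.
rewrite (bigID Q)/= -[leLHS]addr0 lerD//; last first.
  by apply: sumr_ge0 => p _; exact: variance_ge0.
(* Only irregular pairs are kept: more than [eps * k^2] of them, each gaining at least
   [k^-2 * eps^4 / 4]. *)
rewrite (@le_trans _ _ (\sum_(p in Q) k%:R ^- 2 * (eps ^+ 4 / 4)))//; last first.
  apply: ler_sum => -[i j] /= /asboolPn; exact: variance_irregular.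
rewrite sumr_const -[leRHS]mulr_natr.
have -> : eps ^+ 5 / 4 = k%:R ^- 2 * (eps ^+ 4 / 4) * (eps * k%:R ^+ 2).
  by field; rewrite gt_eqF.
by rewrite ler_wpM2l ?(ltW irr)// mulr_ge0// ?divr_ge0 ?invr_ge0 ?exprn_ge0// ltW.
Qed.

End regularity.

(** * Iteration of the increment and the bound on the number of parts *)

Lemma exists_regular_refinement (R : realType) (f : plane R -> R) (eps : R)
    (m t N : nat) :
  measurable_fun (@unit_square R) f ->
  (forall z, @unit_square R z -> 0 <= f z <= 1) ->
  (0 < m)%N -> 0 < eps -> 8 <= t%:R * eps ^+ 2 -> 4 < N.+1%:R * eps ^+ 5 ->
  exists2 n, (n <= N)%N &
    interval_regular_partition f eps (@equipartition R (m * t ^ n)).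
Proof.
move=> mf f01 m0 e0 te Ne; apply: contrapT => noreg.
have t0 : (0 < t)%N by rewrite -(ltr0n R); have := sqr_ge0 eps; nra.
(* If all of the partitions up to exponent [N] are irregular, then [N.+1] increments occur, and
   their total [N.+1 * eps^5 / 4] exceeds the maximal energy 1. *)
have grow n : (n <= N.+1)%N ->
    n%:R * (eps ^+ 5 / 4) <= @energy R f (m * t ^ n).
  elim: n => [_|n ih nN]; first by rewrite mul0r energy_ge0.
  rewrite expnSr mulnA -natr1 mulrDl mul1r.
  apply: le_trans (@energy_increment _ _ mf f01 _ _ _ _ e0 te _).
  - by rewrite lerD2r ih// ltnW.
  - by rewrite muln_gt0 m0 expn_gt0 t0.
  - by move=> reg; apply: noreg; exists n.
have := le_trans (grow N.+1 (leqnn _)) (energy_le1 mf f01 _).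
by move: (N.+1)%:R Ne => r; lra.
Qed.

Theorem theorem7p7 (R : realType) :
  exists C : R, 0 < C /\
  forall (eps : R) (m : nat), 0 < eps -> eps <= 1 -> (0 < m)%N ->
  let M : R := m%:R * eps `^ (- (C * eps ^- 5)) in
  forall f : plane R -> R,
    measurable_fun (@unit_square R) f ->
    (forall z, @unit_square R z -> 0 <= f z <= 1) ->
  exists k : nat, [/\ (m <= k)%N, k%:R <= M &
    interval_regular_partition f eps (@equipartition R k)].
Proof.
exists 48; split => // eps m e0 e1 m0 M f mf f01.
(* Near [eps = 1] the bound [M] leaves no room for refinement (it equals [m] at [eps = 1]), so
   [k = m] has to work there. *)
have [e45|e45] := leP (4 / 5) eps.
  exists m; split => //.
    rewrite /M ler_peMr// -[leLHS](powRr0 eps) ger_powR ?e0//.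
    by rewrite oppr_le0 mulr_ge0// invr_ge0 exprn_ge0// ltW.
  rewrite /interval_regular_partition eq_card0.
    by rewrite mulr_ge0 ?sqr_ge0// ltW.
  move=> p; rewrite !inE; apply/negbF/asboolP.
  exact: interval_regular_cell_large_eps.
have e20 : 0 < eps ^+ 2 by rewrite exprn_gt0.
have e50 : 0 < eps ^+ 5 by rewrite exprn_gt0.
(* The successor makes [t] exceed [8 / eps^2], while [N] is the largest integer not above
   [4 / eps^5], so that [N.+1] increments are impossible. *)
pose t := (Num.truncn (8 / eps ^+ 2)).+1; pose N := Num.truncn (4 / eps ^+ 5).
have /andP[tl tu] : t.-1%:R <= 8 / eps ^+ 2 < t%:R.
  by apply: truncn_itv; rewrite divr_ge0// ltW.
have /andP[Nl Nu] : N%:R <= 4 / eps ^+ 5 < N.+1%:R.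
  by apply: truncn_itv; rewrite divr_ge0// ltW.
have [||n nN reg] := @exists_regular_refinement R f eps m t N mf f01 m0 e0.
- by rewrite -ler_pdivrMr// ltW.
- by rewrite -ltr_pdivrMr.
exists (m * t ^ n)%N; split => //.
  by rewrite leq_pmulr// expn_gt0.
rewrite natrM ler_pM2l ?ltr0n// natrX.
have tle : t%:R <= eps^-1 ^+ 12.
  (* [t <= 1 + 8 eps^-2 <= 9 eps^-2], and [9 <= eps^-10] as [eps < 4/5]. *)
  have y0 : 0 < eps^-1 by rewrite invr_gt0.
  have y54 : 5 / 4 <= eps^-1.
    by rewrite -[leRHS]mul1r ler_pdivlMr//; lra.
  have h10 : 9 <= eps^-1 ^+ 10.
    rewrite (@le_trans _ _ ((5 / 4) ^+ 10))//; first by lra.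
    by rewrite lerXn2r// nnegrE; lra.
  have h2 : 1 <= eps^-1 ^+ 2 by rewrite exprn_ege1//; lra.
  have : t%:R <= 1 + 8 * eps^-1 ^+ 2.
    by move: tl; rewrite exprVn /t -natr1 /=; lra.
  by rewrite (exprD _ 2 10); nra.
(* The refinement factor [t^n] is at most [eps^(-12 * N)], and [N <= 4 / eps^5] bounds [12 * N] by
   [48 / eps^5]. *)
apply: (@le_trans _ _ ((eps^-1 ^+ 12) ^+ N)).
  rewrite (@le_trans _ _ (t%:R ^+ N))//; first by rewrite ler_weXn2l// ler1n.
  by rewrite lerXn2r// nnegrE// exprn_ge0// invr_ge0 ltW.
have -> : (eps^-1 ^+ 12) ^+ N = eps `^ (- (12 * N)%:R).
  by rewrite -exprM exprVn powRN powR_mulrn// ltW.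
rewrite ger_powR ?e0// lerN2.
by rewrite natrM (_ : 48 = 12 * 4) -?mulrA ?ler_pM2l//; lra.
Qed.
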